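(* Let $L$ be a relational signature, let $D$ be an ultrafilter on a set $I$, let $(M_i,V_i)$, $i\in I$, be structures in signature $L$, let $X$ be a context, and let $v_i\in V_i^X$ for $i\in I$. Then for every formula $\phi(X)$ in context $X$, \[\prod_D M_i\models_{\prod_D v_i}\phi \iff M_i\models_{v_i}\phi \text{ for $D$-many } i,\] where satisfaction on the left is taken in the proto-structure $(\prod_D M_i,\prod_D V_i)$.
   Context: Relations: for $R\subseteq A\times B$ and $a\in A$ put $[a]_R=\{b\in B: aRb\}$. $R$ is surjective if every $a\in A$ has some $b$ with $aRb$, and co-surjective if every $b\in B$ has some $a$ with $aRb$. Let $\pi_R\subseteq R$ consist of those $(a,b)\in R$ such that $a$ is the only element of $A$ related to $b$. $R$ is co-injective if $\pi_R$ is surjective, and co-bijective if it is co-injective and co-surjective. Composition: for $R\subseteq A\times B$, $S\subseteq B\times C$, $R\circ S=\{(a,c):\exists b\,(aRb\wedge bSc)\}$. Co-valuations: a context is a finite set (of variables from a fixed countably infinite supply containing a special variable $*$). A co-valuation on a set $M$ in context $X$ is a co-bijective relation $v\subseteq X\times M$; $\mathrm{Val}(X,M)$ is the set of these. For $w\in\mathrm{Val}(Y,M)$ and $\geq\in\mathrm{Val}(X,Y)$ put $C_\geq(w)=\geq\circ w\subseteq X\times M$; if $v=C_\geq(w)$ we say $v$ is a consolidation of $w$ with pattern $\geq$, and $w$ fragments $v$ with pattern $\geq$. For $v\in\mathrm{Val}(X,M)$, $w\in\mathrm{Val}(Y,M)$, write $x\geq^v_w y$ iff $[x]_v\supseteq[y]_w$.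 Formulas: a signature $L$ is a set of relation symbols $R$ with arities $a(R)$. Formulas in context $X$: $\bot$; $R(x_1,\dots,x_{a(R)})$ with $x_k\in X$; $\neg\phi$ and $\phi\wedge\psi$ for $\phi,\psi$ in context $X$; $\exists^{\mathrm{fr}}_{\geq}\phi$ where $\geq\in\mathrm{Val}(X,Y)$ and $\phi$ is in context $Y$. A proto-structure in $L$ is $(M,\{R^M\}_{R\in L},V)$ where $(M,\{R^M\})$ is a first-order $L$-structure and $V$ is a family of co-valuations on $M$ in contexts that is closed under consolidation: if $w\in V\cap\mathrm{Val}(Y,M)$ and $\geq\in\mathrm{Val}(X,Y)$, $X$ a context, then $C_\geq(w)\in V$. Write $V^X=V\cap\mathrm{Val}(X,M)$. For $v\in V^X$: $M\not\models_v\bot$; $M\models_v R(x_1,\dots,x_m)$ iff there are $a_k\in[x_k]_v$ with $R^M(a_1,\dots,a_m)$; $\neg,\wedge$ as usual; $M\models_v\exists^{\mathrm{fr}}_\geq\phi$ iff there is $w\in V$ with $v=C_\geq(w)$ and $M\models_w\phi$. A structure is a proto-structure satisfying (I) for all $u,v\in V$ there is $w\in V$ fragmenting both $u$ and $v$; (II) for all $R\in L$, $v\in V^X$ and $\bar x\in X^{a(R)}$ with $M\models_v R(\bar x)$, there are $w\in V^Y$, $\bar y\in Y^{a(R)}$ and $\bar a$ with $a_k\in[y_k]_{\pi_w}$ for all $k$, $x_k\geq^v_w y_k$ for all $k$, and $R^M(\bar a)$. Ultraproducts: $\prod_D M_i$ is the usual first-order ultraproduct ($R$ holds of $([a^1_i],\dots,[a^m_i])$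 iff $R^{M_i}(a^1_i,\dots,a^m_i)$ for $D$-many $i$). For $v_i\in V_i^X$, $\prod_D v_i\subseteq X\times\prod_D M_i$ is defined by $(x,[(a_i)])\in\prod_D v_i$ iff $(x,a_i)\in v_i$ for $D$-many $i$; $\prod_D V_i$ is the family of all such $\prod_D v_i$ (over all contexts $X$).
   Formalization: The family ∏_D V_i is taken to consist of all ∏_D v_i with v_i in V_i^X for D-many i, rather than for every i; with every i the claim fails when some V_i has no member in a context. First-order structures are assumed nonempty. *)

(* Defs.v *)
(* Mathematical Components, with the classical layer of MathComp-Analysis. *)
From mathcomp Require Import all_boot finmap.
From mathcomp Require Import boolp classical_sets filter.

Set Implicit Arguments.
Unset Strict Implicit.
Unset Printing Implicit Defensive.

Local Open Scope classical_set_scope.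
Local Open Scope relation_scope.
Local Open Scope quotient_scope.

(* A relation between [A] and [B] is a [set (A * B)].  The class [a]_R is the
   library's [xsection R a], and the composition written R o S on paper
   (first R, then S) is [S \; R]. *)

Definition surjective_rel (A B : Type) (R : set (A * B)) : Prop :=
  forall a, exists b, R (a, b).

Definition co_surjective (A B : Type) (R : set (A * B)) : Prop :=
  forall b, exists a, R (a, b).

Definition pi_rel (A B : Type) (R : set (A * B)) : set (A * B) :=
  [set p | R p /\ forall a, R (a, p.2) -> a = p.1].

Definition co_injective (A B : Type) (R : set (A * B)) : Prop :=
  surjective_rel (pi_rel R).

Definition co_bijective (A B : Type) (R : set (A * B)) : Prop :=
  co_injective R /\ co_surjective R.

Definition var : Type := nat.
Definition star : var := 0.

Definition context : Type := {fset var}.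

Definition Val (X : context) (M : Type) : set (set (X * M)) :=
  [set v | co_bijective v].

Arguments Val : clear implicits.

Definition consolidation (X Y : context) (M : Type)
    (g : set (X * Y)) (w : set (Y * M)) : set (X * M) := w \; g.

Definition fragments (X Y : context) (M : Type)
    (w : set (Y * M)) (v : set (X * M)) : Prop :=
  exists g : set (X * Y), Val X Y g /\ v = consolidation g w.

(* x >=^v_w y *)
Definition val_ge (X Y : context) (M : Type)
    (v : set (X * M)) (w : set (Y * M)) (x : X) (y : Y) : Prop :=
  xsection w y `<=` xsection v x.

Record signature : Type := Signature { symbol :> Type; arity : symbol -> nat }.

Inductive formula (L : signature) : context -> Type :=
| FBot (X : context) : formula L X
| FRel (X : context) (R : L) (x : 'I_(arity R) -> X) : formula L X
| FNot (X : context) (phi : formula L X) : formula L X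
| FAnd (X : context) (phi psi : formula L X) : formula L X
| FEx (X Y : context) (g : set (X * Y)) (hg : Val X Y g)
    (phi : formula L Y) : formula L X.

Arguments FBot {L} X.

Record fo_structure (L : signature) : Type := FOStructure {
  carrier :> Type;
  carrier_inhabited : inhabited carrier;
  interp : forall R : L, ('I_(arity R) -> carrier) -> Prop }.

Record proto_structure (L : signature) : Type := ProtoStructure {
  proto_fo :> fo_structure L;
  covals : forall X : context, set (set (X * proto_fo));
  covals_Val : forall X : context, @covals X `<=` Val X proto_fo;
  covals_consolidation : forall (X Y : context)
      (g : set (X * Y)) (w : set (Y * proto_fo)),
    Val X Y g -> @covals Y w -> @covals X (consolidation g w) }.

Arguments covals {L} p X.

Fixpoint satisfies (L : signature) (M : proto_structure L) (X : context)
    (phi : formula L X) : set (X * M) -> Prop :=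
  match phi in formula _ X return set (X * M) -> Prop with
  | FBot _ => fun _ => False
  | FRel X R x => fun v => exists a : 'I_(arity R) -> M,
      (forall k, xsection v (x k) (a k)) /\ interp a
  | FNot X phi => fun v => ~ satisfies phi v
  | FAnd X phi psi => fun v => satisfies phi v /\ satisfies psi v
  | FEx X Y g _ phi => fun v => exists w : set (Y * M),
      [/\ covals M Y w, v = consolidation g w & satisfies phi w]
  end.

Arguments satisfies {L} M {X} phi v.

Record structure (L : signature) : Type := Structure {
  structure_proto :> proto_structure L;
  common_fragmentation : forall (X Y : context)
      (u : set (X * structure_proto)) (v : set (Y * structure_proto)),
    covals structure_proto X u -> covals structure_proto Y v ->
    exists (Z : context) (w : set (Z * structure_proto)),
      [/\ covals structure_proto Z w, fragments w u & fragments w v];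
  atomic_fragmentation : forall (R : L) (X : context)
      (v : set (X * structure_proto)) (x : 'I_(arity R) -> X),
    covals structure_proto X v -> satisfies structure_proto (FRel x) v ->
    exists (Y : context) (w : set (Y * structure_proto))
        (y : 'I_(arity R) -> Y) (a : 'I_(arity R) -> structure_proto),
      [/\ covals structure_proto Y w,
          forall k, xsection (pi_rel w) (y k) (a k),
          forall k, val_ge v w (x k) (y k)
        & interp a] }.

Lemma ultra_exists_fin (I : Type) (D : set_system I) (UD : UltraFilter D)
    (X : finType) (P : X -> set I) :
  D [set i | exists x, P x i] <-> exists x, D (P x).
Proof.
split=> [DP|[x]]; last by apply: filterS => i Pxi; exists x.
apply: contrapT => nP.
have /filter_forall DnP : forall x, D (~` P x).
  move=> x; have [DPx|//] := in_ultra_setVsetC (P x) UD.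
  by exfalso; apply: nP; exists x.
apply: (@filter_not_empty _ D _).
by apply: filterS (filterI DP DnP) => i [[x Px]] /(_ x).
Qed.

Section Ultraproduct.
Context (I : Type) (D : set_system I) (UD : UltraFilter D).

Section Carrier.
Variable T : I -> Type.

Definition ueq (a b : {classic (forall i, T i)}) : bool :=
  `[< D [set i | a i = b i] >].

Lemma ueq_refl : reflexive ueq.
Proof. by move=> a; apply/asboolP; apply: filterS filterT => i _. Qed.

Lemma ueq_sym : symmetric ueq.
Proof.
by move=> a b; apply/asboolP/asboolP; apply: filterS => i /= ->.
Qed.

Lemma ueq_trans : transitive ueq.
Proof.
move=> b a c /asboolP Dab /asboolP Dbc; apply/asboolP.
by apply: filterS (filterI Dab Dbc) => i /= [-> ->].
Qed.

Canonical ueq_equiv := EquivRel ueq ueq_refl ueq_sym ueq_trans.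

Definition ucarrier : Type := {eq_quot ueq}.

Definition uclass (a : forall i, T i) : ucarrier :=
  \pi_{eq_quot ueq} (a : {classic (forall i, T i)}).

Lemma uclassP (a b : forall i, T i) :
  uclass a = uclass b <-> D [set i | a i = b i].
Proof.
split=> [/eqmodP/asboolP//|Dab].
by apply/eqmodP/asboolP.
Qed.

Lemma uclass_surj (q : ucarrier) : exists a, q = uclass a.
Proof. by exists (repr q); rewrite /uclass reprK. Qed.

(* prod_D v_i *)
Definition uval (X : context) (v : forall i, set (X * T i)) :
    set (X * ucarrier) :=
  [set p | exists a : forall i, T i,
     p.2 = uclass a /\ D [set i | v i (p.1, a i)]].

Lemma uvalE (X : context) (v : forall i, set (X * T i)) x a :
  uval v (x, uclass a) <-> D [set i | v i (x, a i)].
Proof.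
split=> [[b /= [/uclassP Dab Db]]|Da]; last by exists a.
by apply: filterS (filterI Dab Db) => i /= [->].
Qed.

Hypothesis T_inhabited : forall i, inhabited (T i).

Lemma ultra_pick (P : forall i, set (T i)) :
  D [set i | exists b, P i b] -> exists b : forall i, T i, D [set i | P i (b i)].
Proof.
move=> DP.
have h i : exists b, (exists b', P i b') -> P i b.
  have [[b Pb]|nP] := pselect (exists b', P i b'); first by exists b.
  by case: (T_inhabited i) => b; exists b.
exists (fun i => projT1 (cid (h i))).
apply: filterS DP => i /= Pi.
by case: cid => /= b; apply.
Qed.

Lemma uval_Val (X : context) (v : forall i, set (X * T i)) :
  D [set i | Val X (T i) (v i)] -> Val X ucarrier (uval v).
Proof.
move=> DV; split=> [x|q].
  have [|b Db] := @ultra_pick (fun i b => pi_rel (v i) (x, b)).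
    by apply: filterS DV => i [+ _]; apply.
  exists (uclass b); split; first by apply/uvalE; apply: filterS Db => i [].
  move=> x' /= /uvalE Dx'.
  by have [i [[_ /(_ x')] /= e /e]] := @filter_ex _ D _ _ (filterI Db Dx').
have [a ->] := uclass_surj q.
have [|x Dx] := (ultra_exists_fin UD (fun (x : X) i => v i (x, a i))).1.
  by apply: filterS DV => i [_]; apply.
by exists x; apply/uvalE.
Qed.

Lemma uval_consolidation (X Y : context) (g : set (X * Y))
    (w : forall i, set (Y * T i)) :
  uval (fun i => consolidation g (w i)) = consolidation g (uval w).
Proof.
apply/seteqP; split=> -[x q]; have [a ->] := uclass_surj q.
  move=> /uvalE Dg.
  have [|y Dy] := (ultra_exists_fin UD
      (fun (y : Y) i => g (x, y) /\ w i (y, a i))).1.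
    by apply: filterS Dg => i [y /= ? ?]; exists y.
  have [i [gxy _]] := @filter_ex _ D _ _ Dy.
  by exists y => //=; apply/uvalE; apply: filterS Dy => j [].
move=> [y /= gxy /uvalE Dy]; apply/uvalE.
by apply: filterS Dy => i /= wy; exists y.
Qed.

End Carrier.

Variables (L : signature) (M : I -> proto_structure L).

Definition uinterp (R : L) (q : 'I_(arity R) -> ucarrier M) : Prop :=
  exists a : 'I_(arity R) -> forall i, M i,
    (forall k, q k = uclass (a k)) /\
    D [set i | interp (fun k => a k i)].

Lemma uinterpE (R : L) (a : 'I_(arity R) -> forall i, M i) :
  uinterp (fun k => uclass (a k)) <-> D [set i | interp (fun k => a k i)].
Proof.
split=> [[b [ab Db]]|Da]; last by exists a.
have /filter_forall Dab : forall k, D [set i | a k i = b k i].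
  by move=> k; apply/uclassP.
apply: filterS (filterI Dab Db) => i /= [e].
by congr interp; apply/funext => k.
Qed.

Lemma ucarrier_inhabited : inhabited (ucarrier M).
Proof.
apply: inhabits; apply: uclass => i.
exact: inhabited_witness (carrier_inhabited (M i)).
Qed.

Definition ufo : fo_structure L := FOStructure ucarrier_inhabited uinterp.

(* The family prod_D V_i: in each context [X], the relations prod_D v_i where
   v_i is a member of V_i in context [X] for D-many [i].  The remaining
   coordinates are irrelevant to prod_D v_i, but one cannot ask for
   v_i in V_i at every [i]: V_i may have no member in context [X] (a one-point
   M_i has co-valuations in one-variable contexts only). *)
Definition ucovals (X : context) : set (set (X * ufo)) :=
  [set u | exists v : forall i, set (X * M i),
     D [set i | covals (M i) X (v i)] /\ u = uval v].

Lemma ucovals_Val (X : context) : @ucovals X `<=` Val X ufo.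
Proof.
move=> _ [v [Dv ->]]; apply: uval_Val.
  by move=> i; exact: carrier_inhabited.
by apply: filterS Dv => i /= /covals_Val.
Qed.

Lemma ucovals_consolidation (X Y : context) (g : set (X * Y))
    (w : set (Y * ufo)) :
  Val X Y g -> ucovals w -> ucovals (consolidation g w).
Proof.
move=> Vg [w' [Dw ->]]; exists (fun i => consolidation g (w' i)).
split; last by rewrite uval_consolidation.
by apply: filterS Dw => i /=; exact: covals_consolidation.
Qed.

Definition ultraproduct : proto_structure L :=
  ProtoStructure ucovals_Val ucovals_consolidation.

End Ultraproduct.

Arguments uclass {I D} UD {T} a.
Arguments uval {I D} UD {T X} v.
Arguments ultraproduct {I D} UD {L} M.

(* Main.v *)
(** Induction on the formula, for arbitrary families of relations [v_i].  The
    one quantifier step rests on two facts: consolidation by a fixed pattern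
    commutes with the ultraproduct, and prod_D v_i = prod_D w_i only if
    v_i = w_i for D-many i.  The latter uses that contexts are finite, so that
    a failure for D-many i happens at one and the same variable. *)
Require Import Defs.
From mathcomp Require Import all_boot finmap.
From mathcomp Require Import boolp classical_sets filter.

Local Open Scope classical_set_scope.

Lemma ultra_setC (I : Type) (D : set_system I) (UD : UltraFilter D)
    (A : set I) : D (~` A) <-> ~ D A.
Proof.
split=> [DnA DA|nDA]; last by have [/nDA|] := in_ultra_setVsetC A UD.
by have [i []] := @filter_ex _ D _ _ (filterI DA DnA).
Qed.

(** If inclusion fails for D-many [i], fix one variable [x] at which it fails D-often and choose
    counterexamples [b i]. Their class is related to [x] in the left ultraproduct but not in the
    right one. *)
Lemma uval_subset (I : Type) (D : set_system I) (UD : UltraFilter D)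
    (T : I -> Type) (T_inhabited : forall i, inhabited (T i)) (X : context)
    (v w : forall i, set (X * T i)) :
  uval UD v `<=` uval UD w -> D [set i | v i `<=` w i].
Proof.
move=> vw; apply: contrapT => /(ultra_setC _ _ UD) nvw.
have [|x Dx] := (ultra_exists_fin UD
    (fun (x : X) i => exists b, v i (x, b) /\ ~ w i (x, b))).1.
  apply: filterS nvw => i /= /existsNP[[x b]] /not_implyP[vb wb].
  by exists x, b.
have [b Db] := ultra_pick UD T_inhabited Dx.
have /vw/uvalE Dw : uval UD v (x, uclass UD b).
  by apply/uvalE; apply: filterS Db => i [].
by have [i [[_ +] +]] := @filter_ex _ D _ _ (filterI Db Dw).
Qed.

Lemma uval_eqP (I : Type) (D : set_system I) (UD : UltraFilter D)
    (T : I -> Type) (T_inhabited : forall i, inhabited (T i)) (X : context)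
    (v w : forall i, set (X * T i)) :
  uval UD v = uval UD w <-> D [set i | v i = w i].
Proof.
split=> [/seteqP[/uval_subset Dvw /uval_subset Dwv]|Dvw].
  apply: filterS (filterI (Dvw T_inhabited) (Dwv T_inhabited)) => i [vw wv].
  exact/seteqP.
apply/seteqP; split=> -[x q]; have [a ->] := uclass_surj q;
  by move=> /uvalE Da; apply/uvalE; apply: filterS (filterI Dvw Da) => i [/= ->].
Qed.

(** Leaving [v] arbitrary lets the induction hypothesis apply to the [w i] of the quantifier step,
    which are co-valuations of [M i] only for D-many [i]. *)
Lemma los_covaluation (L : signature) (I : Type) (D : set_system I)
    (UD : UltraFilter D) (M : I -> proto_structure L) (X : context)
    (phi : formula L X) (v : forall i : I, set (X * M i)) :
  satisfies (ultraproduct UD M) phi (uval UD v)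
  <-> D [set i | satisfies (M i) phi (v i)].
Proof.
have M_inh i : inhabited (M i) by exact: carrier_inhabited.
elim: phi v => {X}
  [X|X R x|X phi IH|X phi IHphi psi IHpsi|X Y g hg phi IH] v /=.
- by split=> // /(@filter_ex _ D) [].
- split=> [[q [vq [a [qa Da]]]]|Da].
    (* The arity is finite, so a single D-large set serves all positions [k]. *)
    have /filter_forall Dv : forall k, D [set i | v i (x k, a k i)].
      by move=> k; apply/uvalE; rewrite -qa; apply/set_mem; exact: vq.
    apply: filterS (filterI Dv Da) => i [/= va ia].
    by exists (fun k => a k i); split=> // k; exact/mem_set/va.
  (* Whole tuples are picked at once, hence [a] takes the index [i] first; constant tuples show that
     the tuple types are inhabited. *)
  have [|a Daa] := ultra_pick UD _ Da.
    by move=> i; case: (M_inh i) => c; apply: inhabits => _; exact: c.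
  exists (fun k => uclass UD (fun i => a i k)); split=> [k|].
    apply/mem_set/uvalE; apply: filterS Daa => i [/(_ k) va _].
    exact: set_mem va.
  by apply/uinterpE; apply: filterS Daa => i [].
- split=> [nphi|]; first by apply/ultra_setC => /IH.
  by move=> /(ultra_setC _ _ UD) nphi /IH.
- split=> [[/IHphi Dphi /IHpsi Dpsi]|Dand]; first exact: filterI.
  by split; [apply/IHphi|apply/IHpsi]; apply: filterS Dand => i [].
- split=> [[_ [[w [Dw ->]]]]|Dex].
    rewrite -uval_consolidation => /(uval_eqP _ _ _ _ M_inh) Dvw /IH Dphi.
    apply: filterS (filterI Dw (filterI Dvw Dphi)) => i [wV [vw wphi]].
    by exists (w i).
  (* Where no witness exists, [w i] is an arbitrary relation; [ucovals] tolerates this off a D-large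
     set. *)
  have [|w Dwe] := ultra_pick UD _ Dex; first by move=> i; exact: inhabits set0.
  exists (uval UD w); split.
  + by exists w; split=> //; apply: filterS Dwe => i [].
  + rewrite -uval_consolidation; apply/(uval_eqP _ _ _ _ M_inh).
    by apply: filterS Dwe => i [].
  + by apply/IH; apply: filterS Dwe => i [].
Qed.

Theorem mainTheorem1 (L : signature) (I : Type) (D : set_system I)
    (UD : UltraFilter D) (M : I -> structure L) (X : context)
    (v : forall i : I, set (X * M i))
    (hv : forall i : I, covals (M i) X (v i))
    (phi : formula L X) :
  satisfies (ultraproduct UD (fun i => structure_proto (M i))) phi (uval UD v)
  <-> D [set i | satisfies (M i) phi (v i)].
Proof. exact: los_covaluation. Qed.
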